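(* Let $w=(w_1,\ldots,w_m)\in(0,1)^m$ be weights such that $w_1+\cdots+w_m=1$, and let $A_1,\ldots,A_m\in\mathrm{UT}_3$. Then the $w$-weighted Karcher mean is $X=G(w;A_1,\ldots,A_m)=DX'$, where $$X'=G(w;A_{(1)},\ldots,A_{(m)})=\begin{bmatrix}1&x'_{12}&x'_{13}\\0&1&x'_{23}\\0&0&1\end{bmatrix},$$ and the entries $x'_{12},x'_{23},x'_{13}$ are given by $$x'_{12}=\frac1{c_{12}}\sum_{i=1}^m w_i\,\log^{[1]}\bigl(a^{(i)}_{11},a^{(i)}_{22}\bigr)\,a^{(i)}_{12},\qquad x'_{23}=\frac1{c_{23}}\sum_{i=1}^m w_i\,\log^{[1]}\bigl(a^{(i)}_{22},a^{(i)}_{33}\bigr)\,a^{(i)}_{23},$$ $$x'_{13}=\frac1{c_{13}}\sum_{i=1}^m w_i\Bigl[\log^{[1]}\bigl(a^{(i)}_{11},a^{(i)}_{33}\bigr)\bigl(a^{(i)}_{13}-x'_{12}a^{(i)}_{23}+x'_{12}x'_{23}a^{(i)}_{33}\bigr)+\log^{[2]}\bigl(a^{(i)}_{11},a^{(i)}_{22},a^{(i)}_{33}\bigr)\bigl(a^{(i)}_{12}-x'_{12}a^{(i)}_{22}\bigr)\bigl(a^{(i)}_{23}-x'_{23}a^{(i)}_{33}\bigr)\Bigr].$$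
   Context: $\mathrm{UT}_n$ is the Lie group of $n\times n$ real upper triangular matrices with positive diagonal entries; $\log:\mathrm{UT}_n\to\mathfrak{ut}_n$ is the inverse of the matrix exponential $\exp:\mathfrak{ut}_n\to\mathrm{UT}_n$, where $\mathfrak{ut}_n$ is the space of real upper triangular $n\times n$ matrices, and $A^{w}=\exp(w\log A)$. The $w$-weighted Karcher mean $G(w;A_1,\ldots,A_m)$ is the (unique) solution $X\in\mathrm{UT}_n$ of $\sum_{i=1}^m w_i\log(X^{-1}A_i)=0$. Here $D:=\mathrm{diag}(A_1^{w_1}\cdots A_m^{w_m})$ (the diagonal matrix formed from the diagonal entries), $A_{(i)}:=D^{-1}A_i=[a^{(i)}_{pq}]$, and for $p<q$ $$c_{pq}:=\sum_{i=1}^m w_i\,a^{(i)}_{qq}\,\log^{[1]}\bigl(a^{(i)}_{pp},a^{(i)}_{qq}\bigr).$$ $\log^{[k]}$ is the $k$-th divided difference of the scalar logarithm $f=\log$: $f^{[0]}(a_1)=f(a_1)$ and for $k\ge1$, $f^{[k]}(a_1,\ldots,a_{k+1})=\frac{f^{[k-1]}(a_1,\ldots,a_k)-f^{[k-1]}(a_2,\ldots,a_{k+1})}{a_1-a_{k+1}}$ if $a_1\ne a_{k+1}$, and $f^{[k]}(a_1,\ldots,a_{k+1})=\frac{\partial f^{[k-1]}}{\partial x_1}(a_1,\ldots,a_k)$ if $a_1=a_{k+1}$. *)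

(* Defs.v *)
From mathcomp Require Import all_boot all_order all_algebra.
From mathcomp Require Import all_classical all_reals all_analysis.

Set Implicit Arguments.
Unset Strict Implicit.
Unset Printing Implicit Defensive.

Import Order.TTheory GRing.Theory Num.Theory.
Import numFieldNormedType.Exports.

Local Open Scope classical_set_scope.
Local Open Scope ring_scope.

Section Defs.
Variable R : realType.

Section UpperTriangular.
Variable n : nat.
Implicit Types A : 'M[R]_n.

(* MathComp's is_trig_mx means lower triangular. *)
Definition ut_alg : set 'M[R]_n := [set A | is_trig_mx A^T].

Definition UT : set 'M[R]_n := [set A | ut_alg A /\ forall i, 0 < A i i].

Definition expmx A : 'M[R]_n := limn (series (fun k => k`!%:R^-1 *: A ^+ k)).

(* Definite description: `get (unique P)` is the only element satisfying P,
   and is the zero matrix if there is none or more than one. *)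
Definition logmx A : 'M[R]_n :=
  get (unique [set L | ut_alg L /\ expmx L = A]).

Definition powmx A (t : R) : 'M[R]_n := expmx (t *: logmx A).

Definition diag_part A : 'M[R]_n := diag_mx (\row_p A p p).

End UpperTriangular.

Section Karcher.
Variables m n : nat.
Implicit Types (w : 'I_m -> R) (A : 'I_m -> 'M[R]_n).

(* The zero matrix, the value of `get` when there is no unique solution,
   is not in UT for n > 0. *)
Definition karcher w A : 'M[R]_n :=
  get (unique [set X | UT X /\
                 \sum_(i < m) w i *: logmx (invmx X *m A i) = 0]).

(* For square matrices \prod is the matrix product, taken in increasing order
   of the index. *)
Definition karcher_diag w A : 'M[R]_n :=
  diag_part (\prod_(i < m) powmx (A i) (w i)).

End Karcher.

(* f^[k](a_1, ..., a_(k+1)) is divdiff f k [:: a_1; ...; a_(k+1)]: only the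
   first k + 1 entries of the sequence are read. *)
Fixpoint divdiff (f : R -> R) (k : nat) (a : seq R) : R :=
  if k is j.+1 then
    if a`_0 == a`_k then derive1 (fun x : R => divdiff f j (x :: behead a)) a`_0
    else (divdiff f j a - divdiff f j (behead a)) / (a`_0 - a`_k)
  else f a`_0.

Definition matrix_of_rows (n : nat) (rows : seq (seq R)) : 'M[R]_n :=
  \matrix_(p, q) (nth [::] rows p)`_q.

End Defs.

(* Main.v *)
(* A 3x3 upper triangular matrix with diagonal (a, b, c) and entries u, v, w in
   positions (1,2), (2,3), (1,3) has exponential with entries u exp[a,b],
   v exp[b,c] and w exp[a,c] + u v exp[a,b,c], where the brackets are divided
   differences: in the powers of the matrix these are complete homogeneous sums,
   which satisfy the divided difference recurrences exactly.  As
   exp[ln a, ln b] = 1 / ln[a,b] > 0, this triangular system can be inverted,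
   which gives the logarithm with the divided differences of ln.  Left
   multiplication by D^-1 makes the weighted mean of the logarithms of each
   diagonal entry vanish, so the diagonal of the Karcher equation forces
   X' to be unipotent; the other entries are then linear in x'_12, x'_23
   and x'_13 successively, with the nonzero coefficients c_pq. *)
Require Import Defs.
From mathcomp Require Import all_boot all_order all_algebra.
From mathcomp Require Import all_classical all_reals all_analysis.
From mathcomp Require Import ring lra.

Set Implicit Arguments.
Unset Strict Implicit.
Unset Printing Implicit Defensive.

Import Order.TTheory GRing.Theory Num.Theory.
Import numFieldNormedType.Exports.

Local Open Scope classical_set_scope.
Local Open Scope ring_scope.

(* [f'] and [f2] stand for the derivative of f and half its second derivative,
   the values at coinciding arguments. *)
Definition dd1 (R : realType) (f f' : R -> R) x y :=
  if x == y then f' x else (f x - f y) / (x - y).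

Definition dd2 (R : realType) (f f' f2 : R -> R) x y z :=
  if x == z then
    if x == y then f2 x else (dd1 f f' x x - dd1 f f' x y) / (x - y)
  else (dd1 f f' x y - dd1 f f' y z) / (x - z).

(* The complete homogeneous symmetric polynomials of degree k - 1 in two and
   k - 2 in three variables: the divided differences of t |-> t ^ k. *)
Fixpoint hpow2 (R : realType) (x y : R) k :=
  if k is j.+1 then x * hpow2 x y j + y ^+ j else 0.

Fixpoint hpow3 (R : realType) (x y z : R) k :=
  if k is j.+1 then x * hpow3 x y z j + hpow2 y z j else 0.

(** * Divided differences of the exponential as sums of power series *)

Section ExponentialSeries.
Variable R : realType.
Implicit Types (x y z c : R) (u v : R^nat) (k : nat).

(** Partial sums of the exponential generating function of [u] at 1. When [u k] is an entry of the
    [k]-th power of a matrix, these are that entry of the partial sums of the matrix exponential. *)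
Definition exp_gen u : R^nat := series (fun k => k`!%:R^-1 * u k).

Lemma hpow2_diff x y k : (x - y) * hpow2 x y k = x ^+ k - y ^+ k.
Proof.
elim: k => [|k IHk] /=; first by rewrite mulr0 !expr0 subrr.
by rewrite mulrDr mulrCA IHk !exprS; ring.
Qed.

Lemma hpow2_diag x k : hpow2 x x k = k%:R * x ^+ k.-1.
Proof.
elim: k => [|k IHk] /=; first by rewrite mul0r.
rewrite IHk; case: k {IHk} => [|k] /=; first by rewrite !expr0; ring.
by rewrite exprS -[in RHS]natr1; ring.
Qed.

(** The divided difference recurrence with its denominator cleared, so that no case distinction is
    needed in the induction. *)
Lemma hpow3_diff x y z k : (x - z) * hpow3 x y z k = hpow2 x y k - hpow2 y z k.
Proof.
elim: k => [|k IHk] /=; first by rewrite mulr0 subrr.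
have := hpow2_diff y z k; rewrite mulrDr mulrCA IHk => h.
have -> : y ^+ k = z ^+ k + (y - z) * hpow2 y z k by rewrite h; ring.
by ring.
Qed.

(** For [z = x] the previous recurrence only says that [hpow2] is symmetric; this one still
    determines [hpow3 x y x] when [x] and [y] differ. *)
Lemma hpow3_diff_diag x y k :
  (x - y) * hpow3 x y x k = hpow2 x x k - hpow2 x y k.
Proof.
elim: k => [|k IHk] /=; first by rewrite mulr0 subrr.
have h := hpow2_diff y x k; rewrite mulrDr mulrCA IHk.
have -> : y ^+ k = x ^+ k + (y - x) * hpow2 y x k by rewrite h; ring.
by ring.
Qed.

(** The right side is the second derivative of t ^ k. The truncated predecessors are harmless: for
    [k] at most 1 one of the numeric factors is 0. *)
Lemma hpow3_diag x k :
  2 * hpow3 x x x k = k%:R * (k.-1%:R * x ^+ k.-2).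
Proof.
elim: k => [|k IHk] /=; first by rewrite mul0r mulr0.
rewrite mulrDr mulrCA IHk hpow2_diag.
case: k {IHk} => [|[|k]] /=; [by ring | by rewrite !expr0; ring |].
by rewrite exprS -[in RHS]natr1 -[k.+1%:R]natr1 -[k.+2%:R]natr1 -[k.+1%:R]natr1; ring.
Qed.

Lemma exp_gen_cvgZ c u (l : R) :
  exp_gen u @ \oo --> l -> exp_gen (fun k => c * u k) @ \oo --> c * l.
Proof.
move=> ul; rewrite (_ : exp_gen _ = (fun n => c * exp_gen u n)).
  by apply: cvgM => //; exact: cvg_cst.
apply/funext => n; rewrite /exp_gen /series /= mulr_sumr.
by apply: eq_bigr => k _; ring.
Qed.

Lemma exp_gen_cvgD u v (l l' : R) :
  exp_gen u @ \oo --> l -> exp_gen v @ \oo --> l' ->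
  exp_gen (fun k => u k + v k) @ \oo --> l + l'.
Proof.
move=> ul vl; rewrite (_ : exp_gen _ = (fun n => exp_gen u n + exp_gen v n)).
  exact: cvgD.
apply/funext => n; rewrite /exp_gen /series /= -big_split /=.
by apply: eq_bigr => k _; rewrite mulrDr.
Qed.

Lemma exp_gen_cvg_div c u v (l : R) : c != 0 ->
  (forall k, c * u k = v k) -> exp_gen v @ \oo --> l ->
  exp_gen u @ \oo --> l / c.
Proof.
move=> c0 cu vl; have := @exp_gen_cvgZ c^-1 _ _ vl; rewrite mulrC.
by rewrite (_ : (fun k => _) = u)//; apply/funext => k;
  apply: (mulfI c0); rewrite cu; field.
Qed.

Lemma exp_gen_expr x : exp_gen (fun k => x ^+ k) @ \oo --> expR x.
Proof.
have := is_cvg_series_exp_coeff x; rewrite /expR; set s := series _.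
by rewrite (_ : exp_gen _ = s)//; apply/funext => n; apply: eq_bigr => k _;
  rewrite /exp_coeff /= mulrC.
Qed.

(** The factor [k] cancels against [k!], leaving the series of [u] delayed by one index; the term at
    [k = 0] vanishes. *)
Lemma exp_gen_shift u (l : R) : exp_gen u @ \oo --> l ->
  exp_gen (fun k => k%:R * u k.-1) @ \oo --> l.
Proof.
move=> ul; rewrite -cvg_shiftS (_ : [sequence _]_n = exp_gen u)//.
apply/funext => n; rewrite /exp_gen /series /= big_nat_recl//= mul0r mulr0 add0r.
apply: eq_bigr => k _; rewrite factS natrM invfM mulrACA.
by rewrite mulVf ?pnatr_eq0// mul1r.
Qed.

Lemma exp_gen_hpow2 x y : exp_gen (hpow2 x y) @ \oo --> dd1 expR expR x y.
Proof.
rewrite /dd1; case: eqVneq => [<-|xy].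
  rewrite (_ : hpow2 x x = fun k => k%:R * x ^+ k.-1).
    exact: (@exp_gen_shift (fun k => x ^+ k) _ (@exp_gen_expr x)).
  by apply/funext => k; rewrite hpow2_diag.
apply: (@exp_gen_cvg_div _ _ (fun k => x ^+ k + (-1) * y ^+ k) _).
- by rewrite subr_eq0.
- by move=> k; rewrite hpow2_diff; ring.
- rewrite -[X in _ - X]mul1r -mulNr.
  by apply: exp_gen_cvgD; [|apply: exp_gen_cvgZ]; exact: exp_gen_expr.
Qed.

Lemma exp_gen_hpow3 x y z :
  exp_gen (hpow3 x y z) @ \oo --> dd2 expR expR (fun t => expR t / 2) x y z.
Proof.
have hB a b c d : exp_gen (fun k => hpow2 a b k + (-1) * hpow2 c d k) @ \oo -->
    dd1 expR expR a b - dd1 expR expR c d.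
  rewrite -[X in _ - X]mul1r -mulNr.
  by apply: exp_gen_cvgD; [|apply: exp_gen_cvgZ]; exact: exp_gen_hpow2.
rewrite /dd2; case: eqVneq => [<-|xz]; last first.
  apply: (@exp_gen_cvg_div _ _ _ _ _ _ (hB _ _ _ _)).
    by rewrite subr_eq0.
  by move=> k; rewrite hpow3_diff; ring.
case: eqVneq => [<-|xy]; last first.
  apply: (@exp_gen_cvg_div _ _ _ _ _ _ (hB _ _ _ _)).
    by rewrite subr_eq0.
  by move=> k; rewrite hpow3_diff_diag; ring.
(* All three arguments coincide: the divisor is 2, and the remaining series is the one of [expR x]
   shifted twice. *)
apply: (@exp_gen_cvg_div _ _ (fun k => k%:R * (k.-1%:R * x ^+ k.-2)) _) => //.
  by move=> k; rewrite hpow3_diag; ring.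
apply: (@exp_gen_shift (fun k => k%:R * x ^+ k.-1)).
exact: (@exp_gen_shift (fun k => x ^+ k) _ (@exp_gen_expr x)).
Qed.

End ExponentialSeries.

(** * Divided differences of [ln], and their relation to those of [expR] *)

Section DividedDifferences.
Variable R : realType.
Implicit Types a b c : R.

Definition ln_dd1 a b := dd1 (@ln R) (fun t => t^-1) a b.
Definition ln_dd2 a b c :=
  dd2 (@ln R) (fun t => t^-1) (fun t => - (2 * t ^+ 2)^-1) a b c.
Definition exp_dd1 a b := dd1 (@expR R) expR a b.
Definition exp_dd2 a b c := dd2 (@expR R) expR (fun t => expR t / 2) a b c.

Lemma ln_eq a b : 0 < a -> 0 < b -> (ln a == ln b) = (a == b).
Proof. by move=> a0 b0; apply/eqP/eqP => [/ln_inj ->//|->]. Qed.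

(** By strict monotonicity of [ln]. This is what makes the coefficients c_pq invertible. *)
Lemma ln_dd1_gt0 a b : 0 < a -> 0 < b -> 0 < ln_dd1 a b.
Proof.
move=> a0 b0; rewrite /ln_dd1 /dd1; case: eqVneq => [_|]; first by rewrite invr_gt0.
rewrite neq_lt => /orP[] ab; last by rewrite divr_gt0// subr_gt0// ltr_ln.
by rewrite -mulrNN -invrN !opprB divr_gt0// subr_gt0// ltr_ln.
Qed.

Lemma exp_dd1_ln a b : 0 < a -> 0 < b -> exp_dd1 (ln a) (ln b) = (ln_dd1 a b)^-1.
Proof.
move=> a0 b0; rewrite /exp_dd1 /ln_dd1 /dd1 ln_eq// !lnK//.
by case: eqP => _; rewrite ?invrK// invf_div.
Qed.

Lemma exp_dd1_gt0 a b : 0 < exp_dd1 a b.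
Proof.
by rewrite -(expRK a) -(expRK b) exp_dd1_ln ?invr_gt0 ?ln_dd1_gt0 ?expR_gt0.
Qed.

(** The discrete analogue of the formula for the second derivative of an inverse function. It makes
    the [u * v] contributions cancel in the corner entry of the exponential of the logarithm. *)
Lemma ln_dd2_exp_dd2 a b c : 0 < a -> 0 < b -> 0 < c ->
  ln_dd2 a b c =
  - (ln_dd1 a c * (ln_dd1 a b * ln_dd1 b c * exp_dd2 (ln a) (ln b) (ln c))).
Proof.
move=> a0 b0 c0; rewrite /exp_dd2 /dd2 -!/(exp_dd1 _ _) !exp_dd1_ln// !ln_eq// lnK//.
have [ab0 bc0 aa0] : [/\ ln_dd1 a b != 0, ln_dd1 b c != 0 & ln_dd1 a a != 0].
  by rewrite !gt_eqF ?ln_dd1_gt0.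
rewrite /ln_dd2 /dd2 -!/(ln_dd1 _ _); case: eqVneq => [ac|ac].
  rewrite -{}ac in bc0 *; case: eqVneq => [ab|ab].
    rewrite -{}ab in ab0 bc0 *; rewrite /ln_dd1 /dd1 eqxx; field; exact: lt0r_neq0.
  (* With [c = a] the factor [ln_dd1 b c] has become [ln_dd1 b a], whereas the coincident branch of
     [dd2] is written with [ln_dd1 a b]. *)
  have -> : ln_dd1 b a = ln_dd1 a b.
    by rewrite /ln_dd1 /dd1 eq_sym (negbTE ab) -mulrNN -invrN !opprB.
  have -> : ln_dd1 a a = a^-1 by rewrite /ln_dd1 /dd1 eqxx.
  have l0 : ln a - ln b != 0 by rewrite subr_eq0 ln_eq.
  move: ab0; rewrite /ln_dd1 /dd1 (negbTE ab) => _.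
  by field; rewrite l0 subr_eq0 ab lt0r_neq0.
have l0 : ln a - ln c != 0 by rewrite subr_eq0 ln_eq.
have -> : ln_dd1 a c = (ln a - ln c) / (a - c) by rewrite /ln_dd1 /dd1 (negbTE ac).
by field; rewrite l0 ab0 bc0 subr_eq0 ac.
Qed.

(** The tail [s] is arbitrary because second order divided differences evaluate the first order ones
    on longer lists. *)
Lemma divdiff_ln1 a b s : 0 < a -> divdiff (@ln R) 1 [:: a, b & s] = ln_dd1 a b.
Proof.
move=> a0; rewrite /ln_dd1 /dd1 /=; case: eqP => // _.
by rewrite derive1E; have [_ <-] := is_derive1_ln a0.
Qed.

(** The second Taylor coefficient of [ln] at [a]. The quotient is also the difference quotient at
    [a] of x |-> [ln_dd1 x a], whose value at [a] is 1 / a. *)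
Lemma cvg_dnbhs_ln_taylor2 a : 0 < a ->
  (ln (h + a) - ln a - h / a) / h ^+ 2 @[h --> 0^'] --> - (2 * a ^+ 2)^-1.
Proof.
(* [lhopital] needs the limit of df / dg on a full neighborhood of 0, so the
   derivatives are modified at 0 to make the quotient continuous there. *)
move=> a0; pose dg (h : R) := if h == 0 then 1 else 2 * h.
have dg0 h : dg h != 0.
  by rewrite /dg; case: (eqVneq h 0) => h0; rewrite ?oner_neq0// mulf_neq0.
(* For nonzero [h] this is 1 / (h + a) - 1 / a = - h / (a (h + a)), written as a multiple of 2 h. *)
pose df h := - (2 * (a * (h + a)))^-1 * dg h.
have inD (h : R) : h \in `]- a, a[ `\ 0 -> 0 < h + a /\ h != 0.
  by rewrite inE /= in_itv /= => -[/andP[h1 h2] /eqP h3]; split => //; lra.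
apply: (@lhopital R (fun h => ln (h + a) - ln a - h / a) df
  (fun h => h ^+ 2) dg (- a) a 0).
- by rewrite in_itv /= oppr_lt0 a0.
- move=> h /inD[h0 h1].
  have dh : is_derive h 1 (fun t : R => t + a) 1.
    by apply: is_derive_eq; rewrite addr0.
  have dl : is_derive h 1 (fun t => ln (t + a)) (h + a)^-1.
    rewrite -[(h + a)^-1]mulr1.
    exact: (@is_derive1_comp _ (@ln R) (fun t => t + a) _ _ _ (is_derive1_ln h0) dh).
  have := is_deriveB (is_deriveB dl (is_derive_cst (ln a) h 1))
                     (is_deriveM (is_derive_id h 1) (is_derive_cst a^-1 h 1)).
  move=> H; refine (is_derive_eq H _).
  rewrite /df /dg (negbTE h1) /GRing.scale /=.
  by field; rewrite !gt_eqF.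
- move=> h /inD[h0 h1]; rewrite /dg (negbTE h1).
  have := is_deriveX 2 (is_derive_id h 1).
  by move=> H; refine (is_derive_eq H _); rewrite /GRing.scale /=; ring.
- have : {for 0, continuous (fun h => ln (h + a) - ln a - h / a)}.
    apply: continuousB; first apply: continuousB; last 2 first.
    + exact: cvg_cst.
    + by apply: continuousM; [exact: cvg_id|exact: cvg_cst].
    + apply: continuous_comp; last by apply: continuous_ln; rewrite /= add0r.
      by apply: continuousD; [exact: cvg_id|exact: cvg_cst].
  by rewrite /prop_for /continuous_at add0r mul0r !subrr.
- have : {for 0, continuous (fun h : R => h ^+ 2)} by exact: exprn_continuous.
  by rewrite /prop_for /continuous_at expr0n.
- by move=> h _; exact: dg0.
- rewrite (_ : (fun h => _) = fun h => - (2 * (a * (h + a)))^-1); last first.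
    by apply/funext => h; rewrite /df mulfK.
  have : {for 0, continuous (fun h => - (2 * (a * (h + a)))^-1)}.
    apply: continuousN; apply: continuousV.
      by rewrite /= add0r !mulf_neq0// gt_eqF.
    apply: continuousM; first exact: cvg_cst.
    apply: continuousM; first exact: cvg_cst.
    by apply: continuousD; [exact: cvg_id|exact: cvg_cst].
  by rewrite /prop_for /continuous_at add0r -expr2.
Qed.

Lemma derive1_ln_dd1_diag a : 0 < a -> derive1 (ln_dd1 ^~ a) a = - (2 * a ^+ 2)^-1.
Proof.
move=> a0; apply/cvg_lim => //.
have := cvg_dnbhs_ln_taylor2 a0; apply: cvg_trans; apply: near_eq_cvg.
near=> h.
have h0 : h != 0 by near: h; exact: nbhs_dnbhs_neq.
rewrite /ln_dd1 /dd1 eqxx -subr_eq0 addrK (negbTE h0).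
by rewrite /GRing.scale /=; field; rewrite h0 gt_eqF.
Unshelve. all: by end_near. Qed.

(** Near [a] the argument stays away from [b], so the quotient rule applies; [ln_dd1 a a] is the
    derivative 1 / a. *)
Lemma derive1_ln_dd1 a b : 0 < a -> 0 < b -> a != b ->
  derive1 (ln_dd1 ^~ b) a = (ln_dd1 a a - ln_dd1 a b) / (a - b).
Proof.
move=> a0 b0 ab; rewrite derive1E.
have ab0 : a - b != 0 by rewrite subr_eq0.
rewrite (@near_eq_derive _ _ _ _ (fun x => (ln x - ln b) / (x - b))); last first.
  near=> x; rewrite /ln_dd1 /dd1 ifF//; apply/negbTE; rewrite -subr_eq0.
  near: x; apply: cvgr_neq0 ab0.
  by apply: cvgB; [exact: cvg_id|exact: cvg_cst].
have dB : is_derive a 1 (fun x => x - b) 1.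
  by apply: is_derive_eq; rewrite subr0.
have := is_deriveM (is_deriveB (is_derive1_ln a0) (is_derive_cst (ln b) a 1))
                   (@is_deriveV _ (fun x => x - b) _ _ _ ab0 dB).
case=> _ ->.
rewrite /ln_dd1 /dd1 eqxx (negbTE ab) /GRing.scale /=.
by rewrite !fctE; field; rewrite ab0 gt_eqF.
Unshelve. all: by end_near. Qed.

Lemma divdiff_ln2 a b c : 0 < a -> 0 < b ->
  divdiff (@ln R) 2 [:: a; b; c] = ln_dd2 a b c.
Proof.
move=> a0 b0; rewrite /ln_dd2 /dd2 -!/(ln_dd1 _ _).
rewrite [LHS]/= -[LHS]/(if a == c then derive1 (fun x => divdiff (@ln R) 1 [:: x; b; c]) a
  else (divdiff (@ln R) 1 [:: a; b; c] - divdiff (@ln R) 1 [:: b; c]) / (a - c)).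
rewrite !divdiff_ln1//.
case: eqP => [<-|//].
(* [divdiff_ln1] requires a positive first argument, so the two functions are only compared near
   [a]. *)
have -> : derive1 (fun x => divdiff (@ln R) 1 [:: x; b; a]) a = derive1 (ln_dd1 ^~ b) a.
  rewrite !derive1E; apply: near_eq_derive.
  near=> x; apply: divdiff_ln1.
  by near: x; exact: lt_nbhsr.
by case: eqVneq => [<-|ab]; [exact: derive1_ln_dd1_diag|exact: derive1_ln_dd1].
Unshelve. all: by end_near. Qed.

End DividedDifferences.

Lemma cvg_mx (R : realType) m n (f : nat -> 'M[R]_(m, n)) (M : 'M[R]_(m, n)) :
  (forall i j, (fun k => f k i j) @ \oo --> M i j) -> f @ \oo --> M.
Proof.
move=> fM; apply/cvg_ballP => e e0; near=> k; split => // i j.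
move: i j; near: k; apply: filter_forall => i; apply: filter_forall => j.
by move/cvg_ballP: (fM i j); exact.
Unshelve. all: by end_near. Qed.

Lemma get_unique_eq (T : pointedType) (P : set T) x :
  P x -> (forall y, P y -> y = x) -> get (unique P) = x.
Proof.
move=> Px Pu; apply: get_unique => [|y [Py _]]; last exact: Pu.
by split => // y /Pu.
Qed.

(** * Upper triangular 3x3 matrices: algebra, exponential and logarithm *)

Definition ut3 (R : realType) (a b c u v w : R) : 'M[R]_3 :=
  matrix_of_rows 3 [:: [:: a; u; w]; [:: 0; b; v]; [:: 0; 0; c]].

Section UpperTriangular3.
Variable R : realType.
Implicit Types (a b c u v w x y z t : R) (A X L : 'M[R]_3).

Local Notation i1 := (@Ordinal 3 0 isT).
Local Notation i2 := (@Ordinal 3 1 isT).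
Local Notation i3 := (@Ordinal 3 2 isT).

Lemma matrix3P A X :
  A i1 i1 = X i1 i1 -> A i1 i2 = X i1 i2 -> A i1 i3 = X i1 i3 ->
  A i2 i1 = X i2 i1 -> A i2 i2 = X i2 i2 -> A i2 i3 = X i2 i3 ->
  A i3 i1 = X i3 i1 -> A i3 i2 = X i3 i2 -> A i3 i3 = X i3 i3 -> A = X.
Proof.
move=> *; apply/matrixP => -[[|[|[|//]]] p] -[[|[|[|//]]] q];
  (* The bound proofs become [isT], so that the indices are literally [i1], [i2], [i3]. *)
  by rewrite !(bool_irrelevance p isT, bool_irrelevance q isT).
Qed.

Lemma ut3E a b c u v w : let A := @ut3 R a b c u v w in
  ((A i1 i1 = a) * (A i2 i2 = b) * (A i3 i3 = c)) *
  ((A i1 i2 = u) * (A i2 i3 = v) * (A i1 i3 = w)) *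
  ((A i2 i1 = 0) * (A i3 i1 = 0) * (A i3 i2 = 0)).
Proof. by rewrite /ut3 /matrix_of_rows; split; [split|]; rewrite !mxE. Qed.

Lemma ut3_inj a b c u v w a' b' c' u' v' w' :
  ut3 a b c u v w = ut3 a' b' c' u' v' w' ->
  [/\ a = a', b = b' & c = c'] /\ [/\ u = u', v = v' & w = w'].
Proof.
move/matrixP => E; split; split;
  have := (E i1 i1, E i2 i2, E i3 i3, E i1 i2, E i2 i3, E i1 i3);
  by rewrite !ut3E => -[[[[[]]]]].
Qed.

Lemma ut_algP A :
  ut_alg A <-> A = ut3 (A i1 i1) (A i2 i2) (A i3 i3) (A i1 i2) (A i2 i3) (A i1 i3).
Proof.
split=> [/is_trig_mxP At|->].
  by apply: matrix3P; rewrite !ut3E//;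
     [have := At i1 i2 isT|have := At i1 i3 isT|have := At i2 i3 isT]; rewrite mxE.
apply/is_trig_mxP => -[[|[|[|//]]] p] -[[|[|[|//]]] q] //= _; rewrite mxE;
  by rewrite (bool_irrelevance p isT) (bool_irrelevance q isT) !ut3E.
Qed.

Lemma ut_alg_ut3 a b c u v w : ut_alg (ut3 a b c u v w).
Proof. by apply/ut_algP; rewrite !ut3E. Qed.

Lemma UT_ut3 a b c u v w :
  UT (ut3 a b c u v w) <-> [/\ 0 < a, 0 < b & 0 < c].
Proof.
split=> [[_ d]|[a0 b0 c0]].
  by have := (d i1, d i2, d i3); rewrite !ut3E => -[[]].
split; first exact: ut_alg_ut3.
by move=> -[[|[|[|//]]] p]; rewrite (bool_irrelevance p isT) ut3E.
Qed.

Lemma UTP A : UT A -> exists a b c u v w,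
  A = ut3 a b c u v w /\ [/\ 0 < a, 0 < b & 0 < c].
Proof.
move=> UA; have [/ut_algP E _] := UA.
by move: UA; rewrite {1}E => /UT_ut3 ?; do 6!eexists; split; [exact: E|].
Qed.

Lemma ut3_mul a b c u v w a' b' c' u' v' w' :
  ut3 a b c u v w *m ut3 a' b' c' u' v' w' =
  ut3 (a * a') (b * b') (c * c') (a * u' + u * b') (b * v' + v * c')
      (a * w' + u * v' + w * c').
Proof.
apply: matrix3P; rewrite !mxE !big_ord_recr big_ord0 /= !mxE /=; ring.
Qed.

Lemma ut3_1 : ut3 1 1 1 0 0 0 = 1%:M :> 'M[R]_3.
Proof. by apply: matrix3P; rewrite !mxE. Qed.

Lemma ut3_0 : ut3 0 0 0 0 0 0 = 0 :> 'M[R]_3.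
Proof. by apply: matrix3P; rewrite !mxE. Qed.

Lemma ut3_eq0 a b c u v w : ut3 a b c u v w = 0 <->
  [/\ a = 0, b = 0 & c = 0] /\ [/\ u = 0, v = 0 & w = 0].
Proof.
split=> [E|[[-> -> ->] [-> -> ->]]]; last exact: ut3_0.
by apply: ut3_inj; rewrite E ut3_0.
Qed.

Lemma ut3_scale t a b c u v w : t *: ut3 a b c u v w =
  ut3 (t * a) (t * b) (t * c) (t * u) (t * v) (t * w).
Proof. by apply: matrix3P; rewrite !mxE //= mulr0. Qed.

Lemma ut3_sum m (a b c u v w : 'I_m -> R) :
  \sum_i ut3 (a i) (b i) (c i) (u i) (v i) (w i) =
  ut3 (\sum_i a i) (\sum_i b i) (\sum_i c i)
      (\sum_i u i) (\sum_i v i) (\sum_i w i).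
Proof.
by apply: matrix3P; rewrite summxE ut3E;
  first [apply: eq_bigr | apply: big1] => i _; rewrite ut3E.
Qed.

Lemma ut3_inv a b c u v w : 0 < a -> 0 < b -> 0 < c ->
  invmx (ut3 a b c u v w) = ut3 a^-1 b^-1 c^-1 (- u / (a * b)) (- v / (b * c))
    ((u * v - b * w) / (a * b * c)).
Proof.
move=> a0 b0 c0; set B := ut3 a^-1 _ _ _ _ _.
have AB : ut3 a b c u v w *m B = 1%:M.
  by rewrite ut3_mul -ut3_1; congr ut3; field; rewrite !gt_eqF.
have [Au _] := mulmx1_unit AB.
by rewrite -[LHS]mulmx1 -AB mulmxA mulVmx// mul1mx.
Qed.

Lemma UT_unitmx A : UT A -> A \in unitmx.
Proof.
move=> /UTP[a [b [c [u [v [w [-> [a0 b0 c0]]]]]]]].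
suff /mulmx1_unit[] : ut3 a b c u v w *m invmx (ut3 a b c u v w) = 1%:M by [].
by rewrite ut3_inv// ut3_mul -ut3_1; congr ut3; field; rewrite !gt_eqF.
Qed.

Lemma UT_mul A X : UT A -> UT X -> UT (A *m X).
Proof.
move=> /UTP[a [b [c [u [v [w [-> [a0 b0 c0]]]]]]]].
move=> /UTP[a' [b' [c' [u' [v' [w' [-> [a'0 b'0 c'0]]]]]]]].
by rewrite ut3_mul; apply/UT_ut3; rewrite !mulr_gt0.
Qed.

Lemma UT_inv A : UT A -> UT (invmx A).
Proof.
move=> /UTP[a [b [c [u [v [w [-> [a0 b0 c0]]]]]]]].
by rewrite ut3_inv//; apply/UT_ut3; rewrite !invr_gt0.
Qed.

(** Left multiplication by the matrix reproduces exactly the recursions that define [hpow2] and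
    [hpow3]. *)
Lemma ut3_exp a b c u v w k : ut3 a b c u v w ^+ k =
  ut3 (a ^+ k) (b ^+ k) (c ^+ k) (u * hpow2 a b k) (v * hpow2 b c k)
      (w * hpow2 a c k + u * v * hpow3 a b c k).
Proof.
elim: k => [|k IHk].
  by rewrite !expr0 /= !mulr0 addr0 ut3_1.
rewrite exprS IHk -[LHS]/(ut3 a b c u v w *m _) ut3_mul /= !exprS.
by congr ut3; ring.
Qed.

Lemma expmx_ut3 a b c u v w : expmx (ut3 a b c u v w) =
  ut3 (expR a) (expR b) (expR c) (u * exp_dd1 a b) (v * exp_dd1 b c)
      (w * exp_dd1 a c + u * v * exp_dd2 a b c).
Proof.
apply/cvg_lim; first exact: norm_hausdorff.
have entry i j (g : R^nat) (l : R) : exp_gen g @ \oo --> l ->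
    (forall k, (ut3 a b c u v w ^+ k) i j = g k) ->
    (fun n => series (fun k => k`!%:R^-1 *: ut3 a b c u v w ^+ k) n i j)
      @ \oo --> l.
  move=> gl E; rewrite (_ : (fun n => _) = exp_gen g)//.
  apply/funext => n; rewrite /exp_gen /series /= summxE.
  by apply: eq_bigr => k _; rewrite mxE E.
have zero : exp_gen (fun=> 0) @ \oo --> (0 : R).
  rewrite (_ : exp_gen _ = cst 0); first exact: cvg_cst.
  by apply/funext => n; apply: big1 => k _; rewrite mulr0.
apply: cvg_mx => -[[|[|[|//]]] p] -[[|[|[|//]]] q];
  rewrite !(bool_irrelevance p isT, bool_irrelevance q isT) ut3E {p q};
  (* Unification with the entry of the [k]-th power determines [g]; the entries below the diagonal
     are then closed by [zero]. *)
  (apply: entry; last by move=> k; rewrite ut3_exp ut3E; reflexivity) => //.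
- exact: exp_gen_expr.
- exact/exp_gen_cvgZ/exp_gen_hpow2.
- apply: exp_gen_cvgD; first exact/exp_gen_cvgZ/exp_gen_hpow2.
  exact/exp_gen_cvgZ/exp_gen_hpow3.
- exact: exp_gen_expr.
- exact/exp_gen_cvgZ/exp_gen_hpow2.
- exact: exp_gen_expr.
Qed.

Lemma logmx_ut3 a b c u v w : 0 < a -> 0 < b -> 0 < c ->
  logmx (ut3 a b c u v w) =
  ut3 (ln a) (ln b) (ln c) (ln_dd1 a b * u) (ln_dd1 b c * v)
      (ln_dd1 a c * w + ln_dd2 a b c * u * v).
Proof.
move=> a0 b0 c0; apply: get_unique_eq.
  split; first exact: ut_alg_ut3.
  have nz x y : 0 < x -> 0 < y -> ln_dd1 x y != 0.
    by move=> x0 y0; rewrite gt_eqF ?ln_dd1_gt0.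
  rewrite expmx_ut3 !lnK// !exp_dd1_ln// ln_dd2_exp_dd2//.
  by congr ut3; field; rewrite ?nz.
move=> L [/ut_algP ->].
move: (L i1 i1) (L i2 i2) (L i3 i3) (L i1 i2) (L i2 i3) (L i1 i3).
(* Uniqueness: the entries of the given matrix are replaced by those of the exponential of [L], and
   it remains to check that the formula recovers [L]. *)
move=> a' b' c' u' v' w'; rewrite expmx_ut3 => /ut3_inj[[<- <- <-] [<- <- <-]].
rewrite ln_dd2_exp_dd2 ?expR_gt0// !expRK.
have e x y : ln_dd1 (expR x) (expR y) = (exp_dd1 x y)^-1.
  by rewrite -{2}[x]expRK -{2}[y]expRK exp_dd1_ln ?expR_gt0// invrK.
have nz x y : exp_dd1 x y != 0 by rewrite gt_eqF ?exp_dd1_gt0.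
by rewrite !e; congr ut3; field; rewrite ?nz.
Qed.

(** The entries off the diagonal stay anonymous, since powers enter only through the diagonal of
    their product. *)
Lemma powmx_ut3 a b c u v w t : 0 < a -> 0 < b -> 0 < c ->
  exists u' v' w', powmx (ut3 a b c u v w) t =
    ut3 (expR (t * ln a)) (expR (t * ln b)) (expR (t * ln c)) u' v' w'.
Proof.
move=> a0 b0 c0; do 3!eexists.
by rewrite /powmx logmx_ut3// ut3_scale expmx_ut3; reflexivity.
Qed.

Lemma prod_ut3 (I : Type) (r : seq I) (F : I -> 'M[R]_3) (a b c : I -> R) :
  (forall i, exists u v w, F i = ut3 (a i) (b i) (c i) u v w) ->
  exists u v w, \prod_(i <- r) F i =
    ut3 (\prod_(i <- r) a i) (\prod_(i <- r) b i) (\prod_(i <- r) c i) u v w.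
Proof.
move=> Fut; elim: r => [|i r [u [v [w IHr]]]].
  by exists 0, 0, 0; rewrite !big_nil ut3_1.
have [u' [v' [w' Fi]]] := Fut i; do 3!eexists.
by rewrite !big_cons IHr Fi -[LHS]/(_ *m _) ut3_mul; reflexivity.
Qed.

Lemma karcher_diag_ut3 m (w : 'I_m -> R) (A : 'I_m -> 'M[R]_3) :
  (forall i, UT (A i)) ->
  let d p := expR (\sum_i w i * ln (A i p p)) in
  karcher_diag w A = ut3 (d i1) (d i2) (d i3) 0 0 0.
Proof.
move=> UA /=; rewrite /karcher_diag /diag_part.
have [i|u [v [z ->]]] := @prod_ut3 _ (index_enum 'I_m) (fun i => powmx (A i) (w i))
    (fun i => expR (w i * ln (A i i1 i1))) (fun i => expR (w i * ln (A i i2 i2)))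
    (fun i => expR (w i * ln (A i i3 i3))).
  have [/ut_algP E d0] := UA i.
  by rewrite {1}E; exact: powmx_ut3.
by apply: matrix3P; rewrite !mxE /= ?mulr0n ?mulr1n// expR_sum.
Qed.

End UpperTriangular3.

(** * Solving the Karcher equation *)

Section KarcherEquation.
Variables (R : realType) (m : nat) (w : 'I_m -> R).
Hypothesis w_gt0 : forall i, 0 < w i.
Hypothesis w_sum : \sum_i w i = 1.
Implicit Types (a b c u v z : 'I_m -> R) (d x y t : R).

Lemma weighted_sum_gt0 (f : 'I_m -> R) :
  (forall i, 0 < f i) -> 0 < \sum_i w i * f i.
Proof.
move=> f0; have fw i : 0 < w i * f i by rewrite mulr_gt0.
rewrite lt0r sumr_ge0 ?andbT => [|i _]; last exact: ltW.
(* If the sum vanished, so would each of its positive terms; hence there would be no index at all,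
   and the weights would sum to 0. *)
apply/eqP => /psumr_eq0P s0; have/eqP := w_sum.
rewrite [X in X == _]big1 => [|i _]; first by rewrite eq_sym oner_eq0.
by have := fw i; rewrite s0 ?ltxx// => j _; exact: ltW.
Qed.

(** Since the weights sum to 1, [ln d] can be distributed over the terms. *)
Lemma weighted_ln_div (f : 'I_m -> R) d : (forall i, 0 < f i) -> 0 < d ->
  \sum_i w i * ln (d^-1 * f i) = \sum_i w i * ln (f i) - ln d.
Proof.
move=> f0 d0; rewrite -[ln d]mul1r -w_sum mulr_suml -sumrB.
by apply: eq_bigr => i _; rewrite lnM ?posrE ?invr_gt0// lnV//; ring.
Qed.

Section Normalized.
Variables a b c u v z : 'I_m -> R.
Hypotheses (a_gt0 : forall i, 0 < a i) (b_gt0 : forall i, 0 < b i)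
  (c_gt0 : forall i, 0 < c i).
Hypotheses (a_mean : \sum_i w i * ln (a i) = 0)
  (b_mean : \sum_i w i * ln (b i) = 0) (c_mean : \sum_i w i * ln (c i) = 0).

Let M i := ut3 (a i) (b i) (c i) (u i) (v i) (z i).
Let ab := \sum_i w i * b i * ln_dd1 (a i) (b i).
Let bc := \sum_i w i * c i * ln_dd1 (b i) (c i).
Let ac := \sum_i w i * c i * ln_dd1 (a i) (c i).
Let x12 := ab^-1 * \sum_i w i * ln_dd1 (a i) (b i) * u i.
Let x23 := bc^-1 * \sum_i w i * ln_dd1 (b i) (c i) * v i.
Let x13 := ac^-1 * \sum_i w i *
  (ln_dd1 (a i) (c i) * (z i - x12 * v i + x12 * x23 * c i) +
   ln_dd2 (a i) (b i) (c i) * (u i - x12 * b i) * (v i - x23 * c i)).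

Lemma ln_dd1_sum_gt0 (f g : 'I_m -> R) : (forall i, 0 < f i) ->
  (forall i, 0 < g i) -> 0 < \sum_i w i * g i * ln_dd1 (f i) (g i).
Proof.
move=> f0 g0; under eq_bigr do rewrite -mulrA.
by apply: weighted_sum_gt0 => i; rewrite mulr_gt0 ?ln_dd1_gt0.
Qed.

(** Each unknown enters its own entry affinely, which isolates the coefficients [ab], [bc], [ac];
    only the corner entry also involves the other two unknowns. *)
Lemma unipotent_log_sum x y t :
  \sum_i w i *: logmx (invmx (ut3 1 1 1 x y t) *m M i) =
  ut3 0 0 0
    (\sum_i w i * ln_dd1 (a i) (b i) * u i - x * ab)
    (\sum_i w i * ln_dd1 (b i) (c i) * v i - y * bc)
    (\sum_i w i *
       (ln_dd1 (a i) (c i) * (z i - x * v i + x * y * c i) +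
        ln_dd2 (a i) (b i) (c i) * (u i - x * b i) * (v i - y * c i)) - t * ac).
Proof.
have log_i i : logmx (invmx (ut3 1 1 1 x y t) *m M i) =
    ut3 (ln (a i)) (ln (b i)) (ln (c i))
      (ln_dd1 (a i) (b i) * (u i - x * b i)) (ln_dd1 (b i) (c i) * (v i - y * c i))
      (ln_dd1 (a i) (c i) * (z i - x * v i + x * y * c i - t * c i) +
       ln_dd2 (a i) (b i) (c i) * (u i - x * b i) * (v i - y * c i)).
  rewrite ut3_inv// ut3_mul -logmx_ut3//; congr logmx.
  by congr ut3; rewrite !(invr1, mulr1, divr1); ring.
under eq_bigr do rewrite log_i ut3_scale.
rewrite ut3_sum a_mean b_mean c_mean.
by congr ut3; rewrite mulr_sumr -sumrB; apply: eq_bigr => i _; ring.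
Qed.

Lemma karcher_normalizedP (X : 'M[R]_3) :
  UT X /\ \sum_i w i *: logmx (invmx X *m M i) = 0 <->
  X = ut3 1 1 1 x12 x23 x13.
Proof.
have [ab0 bc0 ac0] : [/\ ab != 0, bc != 0 & ac != 0].
  by rewrite !gt_eqF ?ln_dd1_sum_gt0.
split=> [[/UTP[p [q [r [x [y [t [-> [p0 q0 r0]]]]]]]]]|->]; last first.
  split; first exact/UT_ut3.
  have cancel (s d : R) : d != 0 -> s - d^-1 * s * d = 0.
    by move=> d0; rewrite mulrAC mulVf// mul1r subrr.
  by rewrite unipotent_log_sum; apply/ut3_eq0; split; split=> //; exact: cancel.
(* On the diagonal the equation reads - ln p = 0, and likewise for [q] and [r], because the weighted
   means of the logarithms vanish. *)
have diag : \sum_i w i *: logmx (invmx (ut3 p q r x y t) *m M i) = 0 ->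
    [/\ p = 1, q = 1 & r = 1].
  under eq_bigr => i _.
    rewrite ut3_inv// ut3_mul logmx_ut3 ?mulr_gt0 ?invr_gt0// ut3_scale.
    over.
  have ln_eq1 d : 0 < d -> 0 - ln d = 0 -> d = 1.
    by move=> d0 /eqP; rewrite sub0r oppr_eq0 ln_eq0// => /eqP.
  rewrite ut3_sum !weighted_ln_div// a_mean b_mean c_mean.
  by move=> /ut3_eq0[[/ln_eq1-> // /ln_eq1-> // /ln_eq1-> //]].
move=> sol; have [p1 q1 r1] := diag sol; move: sol; rewrite {}p1 {}q1 {}r1.
rewrite unipotent_log_sum => /ut3_eq0[_ [/subr0_eq ex /subr0_eq ey]].
(* [x] and [y] are eliminated first, since the equation for [t] depends on them. *)
have -> : x = x12 by rewrite /x12 ex [RHS]mulrC mulfK.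
have -> : y = x23 by rewrite /x23 ey [RHS]mulrC mulfK.
by move=> /subr0_eq et; rewrite /x13 et [_^-1 * _]mulrC mulfK.
Qed.

End Normalized.

(** The inverse of D X times A_i is the inverse of X times D^-1 A_i, so X |-> D X is a bijection
    between the solutions of the two equations. Uniqueness is carried over along with existence, as
    [karcher] is a definite description. *)
Lemma karcher_left_mul (D : 'M[R]_3) (A : 'I_m -> 'M[R]_3) X0 : UT D ->
  (forall X, UT X /\ \sum_i w i *: logmx (invmx X *m (invmx D *m A i)) = 0 <->
    X = X0) ->
  karcher w A = D *m X0.
Proof.
move=> UD XP; have Du := UT_unitmx UD.
have invDM X : UT X -> invmx (D *m X) = invmx X *m invmx D.
  move=> UX; have Xu := UT_unitmx UX.
  have DX : D *m X *m (invmx X *m invmx D) = 1%:M.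
    by rewrite mulmxA -(mulmxA D) mulmxV// mulmx1 mulmxV.
  have [DXu _] := mulmx1_unit DX.
  by rewrite -[LHS]mulmx1 -DX mulKmx.
have [UX0 X0sol] := (XP X0).2 erefl.
apply: get_unique_eq => [|Y [UY Ysol]].
  split; first exact: UT_mul.
  by rewrite -[RHS]X0sol; apply: eq_bigr => i _; rewrite invDM// mulmxA.
rewrite -[Y](mulKVmx Du); congr (D *m _); apply/XP.
have UDY : UT (invmx D *m Y) by apply: UT_mul => //; exact: UT_inv.
split=> //; rewrite -[RHS]Ysol; apply: eq_bigr => i _.
by rewrite mulmxA -invDM// mulKVmx.
Qed.

End KarcherEquation.

Theorem theorem5p4 (R : realType) (m : nat) (w : 'I_m -> R)
    (A : 'I_m -> 'M[R]_3)
    (w_itv : forall i, 0 < w i < 1)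
    (w_sum : \sum_(i < m) w i = 1)
    (A_UT : forall i, UT (A i)) :
  let log1 (a b : R) := divdiff (@ln R) 1 [:: a; b] in
  let log2 (a b c : R) := divdiff (@ln R) 2 [:: a; b; c] in
  let i1 : 'I_3 := @Ordinal 3 0 isT in
  let i2 : 'I_3 := @Ordinal 3 1 isT in
  let i3 : 'I_3 := @Ordinal 3 2 isT in
  let D := karcher_diag w A in
  let a (i : 'I_m) : 'M[R]_3 := invmx D *m A i in
  let c (p q : 'I_3) := \sum_(i < m) w i * a i q q * log1 (a i p p) (a i q q) in
  let x12 := (c i1 i2)^-1 *
    \sum_(i < m) w i * log1 (a i i1 i1) (a i i2 i2) * a i i1 i2 in
  let x23 := (c i2 i3)^-1 *
    \sum_(i < m) w i * log1 (a i i2 i2) (a i i3 i3) * a i i2 i3 in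
  let x13 := (c i1 i3)^-1 *
    \sum_(i < m) w i *
      (log1 (a i i1 i1) (a i i3 i3) *
         (a i i1 i3 - x12 * a i i2 i3 + x12 * x23 * a i i3 i3) +
       log2 (a i i1 i1) (a i i2 i2) (a i i3 i3) *
         (a i i1 i2 - x12 * a i i2 i2) * (a i i2 i3 - x23 * a i i3 i3)) in
  karcher w A = D *m karcher w a /\
  karcher w a = matrix_of_rows 3 [:: [:: 1; x12; x13];
                                     [:: 0;   1; x23];
                                     [:: 0;   0;   1]].
Proof.
move=> log1 log2 i1 i2 i3 D a c x12 x23 x13.
have w_gt0 i : 0 < w i by have /andP[] := w_itv i.
have DE := karcher_diag_ut3 w A_UT; rewrite /= -/D in DE.
have UD : UT D by rewrite DE; apply/UT_ut3; rewrite !expR_gt0.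
have Ua i : UT (a i) by apply: UT_mul => //; exact: UT_inv.
have aE i : a i = ut3 (a i i1 i1) (a i i2 i2) (a i i3 i3)
    (a i i1 i2) (a i i2 i3) (a i i1 i3).
  by apply/ut_algP; case: (Ua i).
have a_gt0 i p : 0 < a i p p by case: (Ua i).
have a_diag i p : a i p p = (expR (\sum_i w i * ln (A i p p)))^-1 * A i p p.
  have [/ut_algP AE _] := A_UT i.
  rewrite /a DE {1}AE ut3_inv ?expR_gt0// ut3_mul.
  by case: p => -[|[|[|//]]] p; rewrite (bool_irrelevance p isT) ut3E.
(* The logarithm of the [p]-th diagonal entry of [D] is exactly the weighted mean of the
   [ln (A i p p)], which it cancels. *)
have a_mean p : \sum_i w i * ln (a i p p) = 0.
  under eq_bigr do rewrite a_diag.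
  rewrite weighted_ln_div ?expR_gt0// ?expRK ?subrr// => i.
  by case: (A_UT i).
have log1E i p q : log1 (a i p p) (a i q q) = ln_dd1 (a i p p) (a i q q).
  exact: divdiff_ln1.
have log2E i p q r : log2 (a i p p) (a i q q) (a i r r) =
    ln_dd2 (a i p p) (a i q q) (a i r r).
  exact: divdiff_ln2.
have XP X : UT X /\ \sum_i w i *: logmx (invmx X *m a i) = 0 <->
    X = ut3 1 1 1 x12 x23 x13.
  have := @karcher_normalizedP _ _ _ w_gt0 w_sum _ _ _
    (fun i => a i i1 i2) (fun i => a i i2 i3) (fun i => a i i1 i3)
    (a_gt0^~ i1) (a_gt0^~ i2) (a_gt0^~ i3) (a_mean i1) (a_mean i2) (a_mean i3) X.
  under eq_bigr do rewrite -aE.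
  set L := \sum_i _; set Y := ut3 _ _ _ _ _ _ => LY.
  (* Only the notation differs: [Y] is written with [ln_dd1] and [ln_dd2], the left side with
     [divdiff]. *)
  suff -> : ut3 1 1 1 x12 x23 x13 = Y by [].
  have cE p q : c p q = \sum_i w i * a i q q * ln_dd1 (a i p p) (a i q q).
    by apply: eq_bigr => i _; rewrite log1E.
  have E12 : x12 = (\sum_i w i * a i i2 i2 * ln_dd1 (a i i1 i1) (a i i2 i2))^-1 *
      \sum_i w i * ln_dd1 (a i i1 i1) (a i i2 i2) * a i i1 i2.
    by rewrite /x12 cE; congr (_ * _); apply: eq_bigr => i _; rewrite log1E.
  have E23 : x23 = (\sum_i w i * a i i3 i3 * ln_dd1 (a i i2 i2) (a i i3 i3))^-1 *
      \sum_i w i * ln_dd1 (a i i2 i2) (a i i3 i3) * a i i2 i3.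
    by rewrite /x23 cE; congr (_ * _); apply: eq_bigr => i _; rewrite log1E.
  rewrite /Y -E12 -E23; congr ut3; rewrite /x13 cE; congr (_ * _).
  by apply: eq_bigr => i _; rewrite log1E log2E.
have Ka : karcher w a = ut3 1 1 1 x12 x23 x13.
  exact: (get_unique_eq ((XP _).2 erefl) (fun Y => (XP Y).1)).
by rewrite Ka; split=> //; exact: karcher_left_mul UD XP.
Qed.
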